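(* Let $q\in L_2(0,1)$ be complex-valued and $\gamma\in\mathbb C\setminus\{0\}$. For any $a\in(0,1]$, the spectrum of the boundary value problem $\mathcal L(q(x),a,\gamma)$ coincides with the spectrum of $\mathcal L(q_a(x),0,\gamma)$, where the function $q_a$ is determined by the formula $$ q_a(x)=\begin{cases} q(x+a), & x\in(0,1-a),\\ \dfrac1\gamma\, q(x+a-1), & x\in(1-a,1).\end{cases} $$
   Context: For a complex-valued $q\in L_2(0,1)$, $a\in[0,1]$ and $\gamma\in\mathbb C\setminus\{0\}$, $\mathcal L(q(x),a,\gamma)$ denotes the boundary value problem $$-y''(x)+q(x)y(a)=\lambda y(x),\quad 0<x<1,\qquad y^{(\nu)}(0)=\gamma y^{(\nu)}(1),\quad \nu=0,1,$$ for $y\in W_2^2[0,1]$, with spectral parameter $\lambda\in\mathbb C$. Let $C(x,\lambda)$, $S(x,\lambda)$ be the solutions of the equation with $C(a,\lambda)=S'(a,\lambda)=1$, $S(a,\lambda)=C'(a,\lambda)=0$; with $\rho^2=\lambda$, $$C(x,\lambda)=\cos\rho(x-a)+\int_a^x\frac{\sin\rho(x-t)}{\rho}q(t)\,dt,\qquad S(x,\lambda)=\frac{\sin\rho(x-a)}{\rho}.$$ The eigenvalues are the zeros of the characteristic function $$\Delta(\lambda)=\begin{vmatrix} C(0,\lambda)-\gamma C(1,\lambda) & S(0,\lambda)-\gamma S(1,\lambda)\\ C'(0,\lambda)-\gamma C'(1,\lambda) & S'(0,\lambda)-\gamma S'(1,\lambda)\end{vmatrix},$$ and the spectrum is the collection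 of zeros of $\Delta$ counted with multiplicity; coincidence of spectra is equality of multisets. *)

(* Defs.v *)
From HB Require Import structures.
From mathcomp Require Import all_boot all_order all_algebra.
From mathcomp Require Import complex.
From mathcomp Require Import all_classical all_reals all_analysis.

Set Implicit Arguments.
Unset Strict Implicit.
Unset Printing Implicit Defensive.

Import Order.TTheory GRing.Theory Num.Theory.
Import numFieldNormedType.Exports.

Local Open Scope classical_set_scope.
Local Open Scope complex_scope.
Local Open Scope ring_scope.

(* The canonical topology and norm of the analysis library are attached to the
   numFieldType structure, not to R[i] itself; derivatives in this type are
   complex derivatives. *)
Definition Cplx (R : realType) : numFieldType := R[i].

Definition L2_01 (R : realType) (f : R -> R[i]) : Prop :=
  ((fun x => complex.Re (f x)) \_ `]0, 1[ : R -> R)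
    \in Lfun (@lebesgue_measure R) 2%:E /\
  ((fun x => complex.Im (f x)) \_ `]0, 1[ : R -> R)
    \in Lfun (@lebesgue_measure R) 2%:E.

Definition Cintegral (R : realType) (D : set R) (f : R -> R[i]) : R[i] :=
  Rintegral (@lebesgue_measure R) D (fun x => complex.Re (f x)) +i*
  Rintegral (@lebesgue_measure R) D (fun x => complex.Im (f x)).

(* y belongs to W_2^2[0,1] with y' = y1 and y'' = y2: y and y1 are absolutely
   continuous, i.e. indefinite Lebesgue integrals of y1 and of y2 in L_2(0,1).
   The values y1 0 and y1 1 are the one-sided derivatives at the end points. *)
Definition W22 (R : realType) (y y1 y2 : R -> R[i]) : Prop :=
  [/\ L2_01 y2,
      forall x : R, 0 <= x <= 1 -> y1 x = y1 0 + Cintegral `[0, x] y2 &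
      forall x : R, 0 <= x <= 1 -> y x = y 0 + Cintegral `[0, x] y1].

(* y is a solution of - y'' + q y(a) = lam y on (0,1), with y' = y1. *)
Definition is_solution (R : realType) (q : R -> R[i]) (a : R) (lam : R[i])
    (y y1 : R -> R[i]) : Prop :=
  exists y2 : R -> R[i],
    W22 y y1 y2 /\
    {ae @lebesgue_measure R, forall x : R,
       0 < x < 1 -> - y2 x + q x * y a = lam * y x}.

Definition boundary_det (R : realType) (gamma : R[i]) (C C1 S S1 : R -> R[i])
    : R[i] :=
  (C 0 - gamma * C 1) * (S1 0 - gamma * S1 1) -
  (S 0 - gamma * S 1) * (C1 0 - gamma * C1 1).

(* Delta is the characteristic function of L(q, a, gamma). The values of C, S
   and of their derivatives on [0,1] are determined by the initial conditions
   at a, so Delta is unique. *)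
Definition is_char_fun (R : realType) (q : R -> R[i]) (a : R) (gamma : R[i])
    (Delta : R[i] -> R[i]) : Prop :=
  forall lam : R[i], exists C C1 S S1 : R -> R[i],
    [/\ is_solution q a lam C C1 /\ (C a = 1 /\ C1 a = 0),
        is_solution q a lam S S1 /\ (S a = 0 /\ S1 a = 1) &
        Delta lam = boundary_det gamma C C1 S S1].

(* f, differentiable in the complex sense, vanishes at z to the exact order m;
   m = 0 means f z != 0. *)
Definition zero_order (R : realType) (f : R[i] -> R[i]) (z : R[i]) (m : nat)
    : Prop :=
  (forall k, (k < m)%N -> derive1n k (f : Cplx R -> Cplx R) z = 0) /\
  derive1n m (f : Cplx R -> Cplx R) z != 0.

(* The spectrum as a multiset of complex numbers, given by the graph of its
   multiplicity function: lam has multiplicity m (with m = 0 when lam is not an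
   eigenvalue). Two spectra coincide as multisets iff these graphs do. *)
Definition spectrum (R : realType) (q : R -> R[i]) (a : R) (gamma : R[i])
    (lam : R[i]) (m : nat) : Prop :=
  exists Delta : R[i] -> R[i],
    is_char_fun q a gamma Delta /\ zero_order Delta lam m.

(* Main.v *)
(* On a circle of length 1 the equation with frozen argument is invariant under
   the rotation by a, up to the factor 1/gamma picked up when passing the end
   point. Let C, S be the fundamental solutions for (q, a), and let T_x be the
   transfer matrix of - y'' = lam y over a length x. Since C(a) = 1, the problem
   (qa, 0) is solved by C(x + a) up to x = 1 - a, and by
   C(x + a - 1) / gamma plus a solution of - y'' = lam y after that point; the
   correction is fixed by continuity of the function and of its derivative at
   1 - a. If M and N are the fundamental matrices of (q, a) and (qa, 0), this
   gives I - gamma N(1) = T_a (M(0) - gamma M(1)), and det T_a = 1, so that both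
   problems have the same characteristic functions. The converse direction
   rotates by 1 - a and multiplies by gamma. No trigonometric functions are
   needed: S itself solves - y'' = lam y because S(a) = 0, and S and S' span the
   solutions of that equation. *)
From HB Require Import structures.
Require Import Defs.
From mathcomp Require Import all_boot all_order all_algebra.
From mathcomp Require Import complex ring lra.
From mathcomp Require Import all_classical all_reals all_analysis measurable_realfun.
Set Implicit Arguments.
Unset Strict Implicit.
Unset Printing Implicit Defensive.
Import Order.TTheory GRing.Theory Num.Theory.
Import numFieldNormedType.Exports.
Local Open Scope classical_set_scope.
Local Open Scope complex_scope.
Local Open Scope ring_scope.

(** * Translation invariance of the Lebesgue measure and integral on the line *)

Section Translation.
Context {R : realType}.
Notation mu := (@lebesgue_measure R).
Local Notation shiftby c :=
  (fun x : measurableTypeR R => (x + c)%R : measurableTypeR R).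

Lemma measurable_translation (c : R) :
  measurable_fun [set: measurableTypeR R] (shiftby c).
Proof. exact: measurable_funD. Qed.

Lemma preimage_translation_itv (b1 b2 : bool) (p q c : R) :
  (fun x => x + c) @^-1` [set` Interval (BSide b1 p) (BSide b2 q)] =
  [set` Interval (BSide b1 (p - c)) (BSide b2 (q - c))].
Proof.
by apply/seteqP; split=> x /=; case: b1 b2 => [] []; rewrite !in_itv/= => /andP[h1 h2];
  apply/andP; split; lra.
Qed.

(** The pushforward gives every half-open interval its length, and the Lebesgue measure is the only
    measure that does so. *)
Lemma lebesgue_measure_translation (c : R) (A : set (measurableTypeR R)) :
  measurable A ->
  pushforward mu (shiftby c) A = mu A.
Proof.
have mphi := @measurable_translation c.
pose phi_mixin := isMeasurableFun.Build _ _ _ _ _ mphi.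
pose phi : {mfun _ >-> _} := HB.pack (shiftby c) phi_mixin.
move=> mA; apply/esym.
apply: (@lebesgue_measure_unique R (pushforward mu phi)) => // _ [[p q] _ <-].
transitivity (mu `]p - c, q - c]%classic).
  rewrite !lebesgue_measure_itv/= !lte_fin ltrD2r.
  by case: ifP => // _; congr EFin; ring.
by congr (mu _); exact/esym/preimage_translation_itv.
Qed.

(** The nonnegative case comes first: applied to [|f|], it gives the integrability of the translate
    that [integral_pushforward] asks for in the signed case. *)
Lemma ge0_integral_translation (c : R) (f : R -> \bar R) :
  measurable_fun [set: R] f -> (forall x, 0 <= f x)%E ->
  (\int[mu]_x f (x + c)%R = \int[mu]_x f x)%E.
Proof.
move=> mf f0.
transitivity (\int[pushforward mu (shiftby c)]_x f x)%E.
  by rewrite ge0_integral_pushforward//; exact: measurable_translation.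
apply: eq_measure_integral => [|? A mA _]; first exact: measurable_translation.
exact: lebesgue_measure_translation.
Qed.

Lemma integrable_translationT (c : R) (f : R -> R) :
  mu.-integrable [set: R] (EFin \o f) ->
  mu.-integrable [set: R] (EFin \o (fun x => f (x + c))).
Proof.
move=> /integrableP[mf intf]; apply/integrableP; split.
  exact: (measurableT_comp mf (@measurable_translation c)).
rewrite (@ge0_integral_translation c (fun x => `|(EFin \o f) x|%E))//.
exact: measurableT_comp.
Qed.

Lemma Rintegral_translationT (c : R) (f : R -> R) :
  mu.-integrable [set: R] (EFin \o f) ->
  \int[mu]_x f (x + c) = \int[mu]_x f x.
Proof.
move=> intf; rewrite /Rintegral; congr fine.
have mf : measurable_fun [set: R] (EFin \o f) by case/integrableP: intf.
transitivity (\int[pushforward mu (shiftby c)]_x (EFin \o f) x)%E.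
  rewrite integral_pushforward//; first exact: measurable_translation.
  exact: integrable_translationT.
apply: eq_measure_integral => [|? A mA _]; first exact: measurable_translation.
exact: lebesgue_measure_translation.
Qed.

Lemma in_preimage_translation (c : R) (D : set R) (x : R) :
  (x \in (fun x => x + c) @^-1` D) = (x + c \in D).
Proof. by apply/idP/idP; rewrite !inE. Qed.

(** Extension by zero outside [D] reduces this to the whole line. *)
Lemma integrable_translation (c : R) (D : set R) (f : R -> R) : measurable D ->
  mu.-integrable D (EFin \o f) ->
  mu.-integrable ((fun x => x + c) @^-1` D) (EFin \o (fun x => f (x + c))).
Proof.
move=> mD intf.
have mD' : measurable ((fun x => x + c) @^-1` D).
  by rewrite -[X in measurable X]setTI; exact: (@measurable_translation c).
have := @integrable_translationT c (f \_ D).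
rewrite -restrict_EFin => /(_ _) h.
have /h : mu.-integrable setT ((EFin \o f) \_ D) by apply/integrable_restrict => //; rewrite setTI.
rewrite (_ : EFin \o _ = (EFin \o (fun x => f (x + c))) \_ ((fun x => x + c) @^-1` D)).
  by move=> /integrable_restrict; rewrite setTI; exact.
by apply/funext => x; rewrite patchE in_preimage_translation /= patchE; case: ifP.
Qed.

Lemma Rintegral_translation (c : R) (D : set R) (f : R -> R) : measurable D ->
  mu.-integrable D (EFin \o f) ->
  \int[mu]_(x in (fun x => x + c) @^-1` D) f (x + c) = \int[mu]_(x in D) f x.
Proof.
move=> mD intf; rewrite [RHS]Rintegral_mkcond [LHS]Rintegral_mkcond.
rewrite -[RHS](@Rintegral_translationT c).
  by apply: eq_Rintegral => x _; rewrite !patchE /= in_preimage_translation.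
by rewrite -restrict_EFin; apply/integrable_restrict => //; rewrite setTI.
Qed.

Lemma ae_translation (c : R) (P : R -> Prop) :
  {ae mu, forall x, P x} -> {ae mu, forall x, P (x + c)}.
Proof.
move=> [N [mN N0 PN]]; exists ((fun x => x + c) @^-1` N); split.
- by rewrite -[X in measurable X]setTI; exact: (@measurable_translation c).
- by rewrite -[LHS]/(pushforward mu (shiftby c) N)
    lebesgue_measure_translation.
- by move=> x /= /PN.
Qed.

End Translation.

(** * Square integrability on the unit interval *)

Section UnitInterval.
Context {R : realType}.
Notation mu := (@lebesgue_measure R).
Local Notation integrable D f := (mu.-integrable D (EFin \o f)).

Lemma integrable_itvoo_cc (p q : R) (f : R -> R) :
  integrable `]p, q[ f -> integrable `[p, q] f.
Proof.
move=> /integrableP[mf intf]; apply/integrableP; split.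
  exact: (@emeasurable_fun_itv_cc _ _ _ false true).
rewrite integral_itv_bndoo//.
exact: measurableT_comp.
Qed.

(** The first conjunct carries measurability and the integrability over the closed interval on which
    primitives are built. *)
Definition sqintegrable (f : R -> R) : Prop :=
  integrable `[0, 1] f /\ integrable `[0, 1] (fun x => f x ^+ 2).

Lemma Lfun2_sqr (f : R -> R) : measurable_fun [set: R] f ->
  integrable [set: R] (fun x => f x ^+ 2) -> f \in Lfun mu 2%:E.
Proof.
move=> mf /integrableP[_ intf].
rewrite inE; apply/andP; split; rewrite inE//= /finite_norm unlock /Lnorm poweR_lty//.
apply: le_lt_trans intf; rewrite le_eqVlt; apply/orP; left; apply/eqP.
apply: eq_integral => x _ /=.
by rewrite normrX powR_mulrn.
Qed.

(** A bridge between two descriptions: sums and multiples are handled in the space [Lfun], gluing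
    and primitives through integrals over [[0, 1]]. *)
Lemma Lfun2_patch (f : R -> R) :
  f \_ `]0, 1[ \in Lfun mu 2%:E <-> sqintegrable f.
Proof.
have m01 : measurable (`]0, 1[ : set R) by [].
split=> [f2|[if1 if2]].
  split; apply: integrable_itvoo_cc.
    (* Multiplying by this indicator and using the Hölder inequality gives integrability, since the
       interval has finite measure. *)
    have i2 : \1_(`]0, 1[) \in Lfun mu 2%:E.
      apply: Lfun2_sqr; first exact: measurable_indic.
      rewrite (_ : (fun x => _) = \1_(`]0, 1[)); last first.
        by apply/funext => x; rewrite indicE; case: (_ \in _); rewrite ?expr1n ?expr0n.
      exact: integrable_indic_itv.
    have := Lfun2_mul_Lfun1 f2 i2.
    move=> /Lfun1_integrable.
    rewrite (_ : EFin \o _ = (EFin \o f) \_ `]0, 1[).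
      by move=> /integrable_restrict; rewrite setTI; exact.
    apply/funext => x; rewrite patchE /= patchE indicE.
    by case: (_ \in _); rewrite /= ?mulr1 ?mulr0.
  have := Lfun2_integrable_sqr f2.
  rewrite (_ : EFin \o _ = (EFin \o (fun x => f x ^+ 2)) \_ `]0, 1[).
    by move=> /integrable_restrict; rewrite setTI; exact.
  apply/funext => x; rewrite patchE /= patchE.
  by case: (_ \in _); rewrite /= ?expr0n.
have sub : `]0, 1[ `<=` (`[0, 1] : set R) by apply: subset_itv; rewrite bnd_simp.
apply: Lfun2_sqr.
  apply/(measurable_restrictT _ _).1 => //.
  apply: measurable_funS sub _ => //.
  by case/integrableP : if1 => /measurable_EFinP.
rewrite (_ : EFin \o _ = (EFin \o (fun x => f x ^+ 2)) \_ `]0, 1[).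
  by apply/integrable_restrict; rewrite ?setTI//; apply: integrableS if2.
apply/funext => x; rewrite patchE /= patchE.
by case: (_ \in _); rewrite /= ?expr0n.
Qed.

Lemma sqintegrableD (f g : R -> R) :
  sqintegrable f -> sqintegrable g -> sqintegrable (fun x => f x + g x).
Proof.
move=> /Lfun2_patch f2 /Lfun2_patch g2; apply/Lfun2_patch.
rewrite (_ : _ \_ _ = f \_ `]0, 1[ + g \_ `]0, 1[).
  exact: (Lfun_addr_closed mu (lee1n 2)).2.
apply/funext => x; rewrite fctE !patchE.
by case: (_ \in _); rewrite ?addr0.
Qed.

Lemma sqintegrableZ (k : R) (f : R -> R) :
  sqintegrable f -> sqintegrable (fun x => k * f x).
Proof.
move=> /Lfun2_patch f2; apply/Lfun2_patch.
rewrite (_ : _ \_ _ = k \o* f \_ `]0, 1[); first exact: (Lfun_scale _ (ler1n R 2)).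
apply/funext => x; rewrite /= !patchE.
by case: (_ \in _); rewrite ?mul0r// mulrC.
Qed.

End UnitInterval.

(* The gluing of two functions on [0, 1] seen through the rotation
   x |-> x + b of the circle: u is read from b to 1, and then v from 0 to b. *)
Definition concat_shift {R : realType} {T : Type} (b : R) (u v : R -> T) (x : R) : T :=
  if x < 1 - b then u (x + b) else v (x + b - 1).

Lemma concat_shift_ge {R : realType} (T : Type) (b x : R) (u v : R -> T) :
  1 - b <= x -> concat_shift b u v x = v (x + b - 1).
Proof. by rewrite /concat_shift leNgt => /negbTE ->. Qed.

(** * Indefinite integrals and their gluing along the rotated circle *)

Section Primitive.
Context {R : realType}.
Notation mu := (@lebesgue_measure R).
Local Notation integrable D f := (mu.-integrable D (EFin \o f)).

Lemma integrableU (A B : set R) (f : R -> R) :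
  measurable A -> measurable B -> [disjoint A & B] ->
  integrable A f -> integrable B f -> integrable (A `|` B) f.
Proof.
move=> mA mB AB /integrableP[mfA fA] /integrableP[mfB fB].
have mf : measurable_fun (A `|` B) (EFin \o f) by apply/measurable_funU.
apply/integrableP; split=> //.
rewrite ge0_integral_setU//; first by rewrite lte_add_pinfty.
exact: measurableT_comp.
Qed.

Lemma Rintegral_itv_cat (p r x : R) (f : R -> R) : p <= r -> r <= x ->
  integrable `[p, x] f ->
  \int[mu]_(t in `[p, x]) f t =
  \int[mu]_(t in `[p, r]) f t + \int[mu]_(t in `[r, x]) f t.
Proof.
move=> pr rx intf.
have := @Rintegral_itvB R f (BLeft p) (BRight x) r intf.
rewrite !bnd_simp => /(_ pr rx).
rewrite Rintegral_itv_obnd_cbnd; first by move=> <-; rewrite addrC subrK.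
by apply: integrableS intf => //; apply: subset_itv; rewrite bnd_simp.
Qed.

(** Cut at the seam [1 - b], the glued function is a translate of [u] from [[b, 1[] and of [v] from
    [[0, b]]. *)
Lemma integrable_concat_shift (b : R) (u v : R -> R) : 0 <= b <= 1 ->
  integrable `[0, 1] u -> integrable `[0, 1] v ->
  integrable `[0, 1] (concat_shift b u v).
Proof.
move=> /andP[b0 b1] iu iv.
rewrite (@itv_bndbnd_setU _ _ _ (BLeft (1 - b))) ?bnd_simp; [|lra|lra].
apply: integrableU => //.
- apply/disj_setPS => y [/=]; rewrite !in_itv/= => /andP[_ h1] /andP[h2 _]; lra.
- have := @integrable_translation R b `[b, 1[ u.
  rewrite preimage_translation_itv subrr => h.
  apply: eq_integrable (h _ _) => //.
    by move=> x; rewrite inE/= in_itv/= => /andP[_ xb]; rewrite /concat_shift xb.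
  by apply: integrableS iu => //; apply: subset_itv; rewrite bnd_simp.
- have := @integrable_translation R (b - 1) `[0, b] v.
  rewrite preimage_translation_itv sub0r opprB (_ : b + (1 - b) = 1); last lra.
  move=> h; apply: eq_integrable (h _ _) => //.
    by move=> x; rewrite inE/= in_itv/= => /andP[xb _]; rewrite /concat_shift ltNge xb/= addrA.
  by apply: integrableS iv => //; apply: subset_itv; rewrite bnd_simp.
Qed.

(** Integrability is recorded because the real-valued integral is a total function with default
    values; cutting and translating the integral rely on it. *)
Definition is_primitive (f g : R -> R) : Prop :=
  integrable `[0, 1] g /\
  forall x : R, 0 <= x <= 1 -> f x = f 0 + \int[mu]_(t in `[0, x]) g t.

Lemma is_primitive_itv (f g : R -> R) (p x : R) : is_primitive f g ->
  0 <= p -> p <= x -> x <= 1 -> f x = f p + \int[mu]_(t in `[p, x]) g t.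
Proof.
move=> [ig fE] p0 px x1; rewrite fE; last by lra.
rewrite (fE p); last by lra.
rewrite (@Rintegral_itv_cat 0 p x)// ?addrA//.
by apply: integrableS ig => //; apply: subset_itv; rewrite bnd_simp.
Qed.

(** The condition [f 1 = h 0] is continuity at the seam [1 - b]: the integral up to the seam ends at
    the value from which the second piece starts. *)
Lemma is_primitive_concat_shift (b : R) (f g h k : R -> R) : 0 <= b <= 1 ->
  is_primitive f g -> is_primitive h k -> f 1 = h 0 ->
  is_primitive (concat_shift b f h) (concat_shift b g k).
Proof.
move=> b01 fg hk fh; have [b0 b1] := andP b01.
have [ig _] := fg; have [ik _] := hk.
have ir := integrable_concat_shift b01 ig ik.
have left x : 0 <= x -> x <= 1 - b -> concat_shift b f h x =
    concat_shift b f h 0 + \int[mu]_(t in `[0, x]) concat_shift b g k t.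
  move=> x0 xb.
  have -> : concat_shift b f h x = f (x + b).
    rewrite /concat_shift; case: ltP => // h1; have -> : x = 1 - b by lra.
    by rewrite subrK subrr.
  have -> : concat_shift b f h 0 = f b.
    rewrite /concat_shift add0r; case: ltP => // h1.
    (* Degenerate rotation: the seam sits at 0, so the glued function starts with [h] already. *)
    have -> : b = 1 by lra.
    by rewrite subrr fh.
  rewrite (@is_primitive_itv f g b)//; [|lra|lra]; congr (_ + _).
  (* The right end point is dropped because at the seam the glued integrand already reads [k]
     instead of [g]. *)
  rewrite -2?Rintegral_itv_bndo_bndc; last 2 first.
  - by apply: integrableS ir => //; apply: subset_itv; rewrite bnd_simp//; lra.
  - by apply: integrableS ig => //; apply: subset_itv; rewrite bnd_simp//; lra.
  rewrite -(@Rintegral_translation _ b)//; last first.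
    by apply: integrableS ig => //; apply: subset_itv; rewrite bnd_simp//; lra.
  rewrite preimage_translation_itv subrr addrK; apply: eq_Rintegral => t.
  rewrite inE/= in_itv/= => /andP[_ tx]; rewrite /concat_shift ifT//; lra.
split=> // x /andP[x0 x1].
have [xb|xb] := leP x (1 - b); first exact: left.
rewrite (@Rintegral_itv_cat 0 (1 - b) x); [|lra|lra|]; last first.
  by apply: integrableS ir => //; apply: subset_itv; rewrite bnd_simp//; lra.
rewrite addrA -left; [|lra|lra].
have rE t : 1 - b <= t -> concat_shift b f h t = h (t + b - 1).
  exact: concat_shift_ge.
rewrite rE; last lra.
rewrite rE//.
have -> : 1 - b + b - 1 = 0 by lra.
rewrite (@is_primitive_itv h k 0)//; [|lra|lra]; congr (_ + _).
rewrite -(@Rintegral_translation _ (b - 1))//; last first.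
  by apply: integrableS ik => //; apply: subset_itv; rewrite bnd_simp//; lra.
rewrite preimage_translation_itv sub0r opprB (_ : x + b - 1 + (1 - b) = x); last lra.
apply: eq_Rintegral => t.
by rewrite inE/= in_itv/= => /andP[tb _]; rewrite /concat_shift ltNge tb/= addrA.
Qed.

Lemma is_primitiveD (f g h k : R -> R) : is_primitive f g -> is_primitive h k ->
  is_primitive (fun x => f x + h x) (fun x => g x + k x).
Proof.
move=> [ig fg] [ik hk]; split.
  by have := integrableD _ ig ik; apply.
move=> x x01; rewrite fg// hk// RintegralD//; first by ring.
- by apply: integrableS ig => //; apply: subset_itv; rewrite bnd_simp//; lra.
- by apply: integrableS ik => //; apply: subset_itv; rewrite bnd_simp//; lra.
Qed.

Lemma is_primitiveZ (c : R) (f g : R -> R) : is_primitive f g ->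
  is_primitive (fun x => c * f x) (fun x => c * g x).
Proof.
move=> [ig fg]; split.
  by have := integrableZl _ c ig; apply.
move=> x x01; rewrite fg// RintegralZl//; first by ring.
by apply: integrableS ig => //; apply: subset_itv; rewrite bnd_simp//; lra.
Qed.

End Primitive.

(** * Continuity and differentiation of primitives *)

Section Calculus.
Context {R : realType}.
Notation mu := (@lebesgue_measure R).
Local Notation integrable D f := (mu.-integrable D (EFin \o f)).

Lemma is_primitive_continuous (f g : R -> R) : is_primitive f g ->
  {within `[0, 1], continuous f}.
Proof.
move=> [ig fg].
have : {within `[0, 1], continuous (cst (f 0) \+ fun x => parameterized_integral mu 0 x g)}.
  move=> x; apply: continuousD; first exact: cst_continuous.
  exact: (parameterized_integral_continuous ler01 ig).
apply: subspace_eq_continuous => x; rewrite inE/= in_itv/= => x01.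
exact: (esym (fg x x01)).
Qed.

Lemma within_continuous_integrable (f : R -> R) :
  {within `[0, 1], continuous f} -> integrable `[0, 1] f.
Proof. by move=> fc; apply: continuous_compact_integrable => //; exact: segment_compact. Qed.

Lemma within_continuous_sqintegrable (f : R -> R) :
  {within `[0, 1], continuous f} -> sqintegrable f.
Proof.
move=> fc; split; apply: within_continuous_integrable => // x.
by rewrite (_ : (fun _ => _) = f \* f)//; apply: continuousM; exact: fc.
Qed.

Lemma within_continuousD (A : set R) (f g : R -> R) :
  {within A, continuous f} -> {within A, continuous g} ->
  {within A, continuous (fun x => f x + g x)}.
Proof. by move=> fc gc x; apply: continuousD; [exact: fc|exact: gc]. Qed.

Lemma within_continuousB (A : set R) (f g : R -> R) :
  {within A, continuous f} -> {within A, continuous g} ->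
  {within A, continuous (fun x => f x - g x)}.
Proof. by move=> fc gc x; apply: continuousB; [exact: fc|exact: gc]. Qed.

Lemma within_continuousM (A : set R) (f g : R -> R) :
  {within A, continuous f} -> {within A, continuous g} ->
  {within A, continuous (fun x => f x * g x)}.
Proof. by move=> fc gc x; apply: continuousM; [exact: fc|exact: gc]. Qed.

(** The fundamental theorem of calculus at an interior point; [f] is known to be the integral on
    [[0, 1]] only, so the derivative is transferred through equality near [x]. *)
Lemma is_primitive_derive (f g : R -> R) (x : R) : is_primitive f g ->
  {within `[0, 1], continuous g} -> 0 < x < 1 -> is_derive x 1 f (g x).
Proof.
move=> [ig fg] gc /andP[x0 x1].
have gx : {for x, continuous g}.
  have /(continuous_within_itvP _ ltr01)[+ _ _] := gc.
  by apply; rewrite in_itv/= x0 x1.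
have [] := continuous_FTC1_closed x1 ig x0 gx.
set F := (fun x => _) => dF F'E.
have dfF : is_derive x 1 (cst (f 0) \+ F) (g x).
  have dF' : is_derive x 1 F (g x) by apply: DeriveDef; [exact: dF | rewrite -derive1E; exact: F'E].
  by rewrite -[g x]add0r; exact: is_deriveD.
apply: near_eq_is_derive dfF.
near=> t; apply/esym/fg/andP; split; apply/ltW; near: t.
- exact: lt_nbhsr.
- exact: lt_nbhsl.
Unshelve. all: by end_near. Qed.

Lemma derive0_constant (f : R -> R) (x y : R) :
  {within `[0, 1], continuous f} ->
  (forall t : R, 0 < t < 1 -> is_derive t 1 f 0) ->
  0 <= x <= 1 -> 0 <= y <= 1 -> f x = f y.
Proof.
move=> fc fd; wlog xy : x y / x <= y.
  by move=> H x01 y01; have [/H|/ltW/H] := leP x y; [exact|move=> <-].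
move=> /andP[x0 _] /andP[_ y1].
have [|| c _] := @MVT_segment R f (cst 0) x y xy.
- by move=> t; rewrite in_itv/= => /andP[h1 h2]; apply: fd; lra.
- apply: continuous_subspaceW fc.
  by apply: subset_itv; rewrite bnd_simp.
- by rewrite mul0r => /eqP; rewrite subr_eq0 => /eqP.
Qed.

(** Serves to replace a second derivative, determined only almost everywhere by the equation, by a
    continuous representative. *)
Lemma is_primitive_ae (f g h : R -> R) : is_primitive f g ->
  integrable `[0, 1] h -> {ae mu, forall x, 0 < x < 1 -> g x = h x} ->
  is_primitive f h.
Proof.
move=> [ig fg] ih gh; split=> // x x01; rewrite fg//; congr (_ + _).
have s01 : `[0, x] `<=` (`[0, 1] : set R) by apply: subset_itv; rewrite bnd_simp; lra.
have igx : integrable `[0, x] g by apply: integrableS ig.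
have ihx : integrable `[0, x] h by apply: integrableS ih.
have so : `]0, x[ `<=` (`[0, x] : set R) by apply: subset_itv; rewrite bnd_simp.
rewrite /Rintegral (@integral_itv_bndoo _ _ _ (EFin \o g)) ?(@integral_itv_bndoo _ _ _ (EFin \o h)); first last.
- by apply: measurable_funS so _ => //; case/integrableP: igx.
- by apply: measurable_funS so _ => //; case/integrableP: ihx.
congr fine; apply: ae_eq_integral => //.
- by apply: measurable_funS so _ => //; case/integrableP: igx.
- by apply: measurable_funS so _ => //; case/integrableP: ihx.
have Fmu := ae_filter_ringOfSetsType mu.
apply: filterS gh => t gh; rewrite /= in_itv/= => /andP[t0 tx]; congr EFin.
by apply: gh; lra.
Qed.

End Calculus.

(** * Complex-valued functions through their real and imaginary parts *)

Section ComplexValued.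
Context {R : realType}.
Notation mu := (@lebesgue_measure R).
Local Notation integrable D f := (mu.-integrable D (EFin \o f)).
Implicit Types (f g y z : R -> R[i]) (k lam : R[i]).

Lemma complex_ReD (u v : R[i]) : complex.Re (u + v) = complex.Re u + complex.Re v.
Proof. by case: u v => [? ?] []. Qed.

Lemma complex_ImD (u v : R[i]) : complex.Im (u + v) = complex.Im u + complex.Im v.
Proof. by case: u v => [? ?] []. Qed.

(** Written as a sum of real multiples of the parts of [v], so that closure under sums and real
    scalars applies directly; likewise for [complex_ImM]. *)
Lemma complex_ReM (u v : R[i]) : complex.Re (u * v) =
  complex.Re u * complex.Re v + - complex.Im u * complex.Im v.
Proof. by case: u v => [? ?] [? ?] /=; rewrite mulNr. Qed.

Lemma complex_ImM (u v : R[i]) : complex.Im (u * v) =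
  complex.Im u * complex.Re v + complex.Re u * complex.Im v.
Proof. by case: u v => [? ?] [? ?] /=; rewrite addrC. Qed.

Lemma L2_01P f : L2_01 f <->
  sqintegrable (fun x => complex.Re (f x)) /\ sqintegrable (fun x => complex.Im (f x)).
Proof.
by split=> -[h1 h2]; split; apply/Lfun2_patch.
Qed.

Lemma L2_01D f g : L2_01 f -> L2_01 g -> L2_01 (fun x => f x + g x).
Proof.
move=> /L2_01P[f1 f2] /L2_01P[g1 g2]; apply/L2_01P; split.
- rewrite (funext (fun x => complex_ReD (f x) (g x))); exact: sqintegrableD.
- rewrite (funext (fun x => complex_ImD (f x) (g x))); exact: sqintegrableD.
Qed.

Lemma L2_01Z k f : L2_01 f -> L2_01 (fun x => k * f x).
Proof.
move=> /L2_01P[f1 f2]; apply/L2_01P; split.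
- rewrite (funext (fun x => complex_ReM k (f x))); apply: sqintegrableD; exact: sqintegrableZ.
- rewrite (funext (fun x => complex_ImM k (f x))); apply: sqintegrableD; exact: sqintegrableZ.
Qed.

Lemma sqintegrable_concat_shift (b : R) (u v : R -> R) : 0 <= b <= 1 ->
  sqintegrable u -> sqintegrable v -> sqintegrable (concat_shift b u v).
Proof.
move=> b01 [u1 u2] [v1 v2]; split; first exact: integrable_concat_shift.
rewrite (_ : (fun _ => _) = concat_shift b (fun x => u x ^+ 2) (fun x => v x ^+ 2)).
  exact: integrable_concat_shift.
by apply/funext => x; rewrite /concat_shift; case: ifP.
Qed.

Lemma comp_concat_shift (T : Type) (h : R[i] -> T) (b : R) f g :
  (fun x => h (concat_shift b f g x)) = concat_shift b (fun x => h (f x)) (fun x => h (g x)).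
Proof. by apply/funext => x; rewrite /concat_shift; case: ifP. Qed.

Lemma L2_01_concat_shift (b : R) f g : 0 <= b <= 1 ->
  L2_01 f -> L2_01 g -> L2_01 (concat_shift b f g).
Proof.
move=> b01 /L2_01P[f1 f2] /L2_01P[g1 g2]; apply/L2_01P.
by rewrite !comp_concat_shift; split; exact: sqintegrable_concat_shift.
Qed.

Definition is_Cprimitive y g : Prop :=
  is_primitive (fun x => complex.Re (y x)) (fun x => complex.Re (g x)) /\
  is_primitive (fun x => complex.Im (y x)) (fun x => complex.Im (g x)).

Lemma is_CprimitiveD y g z h : is_Cprimitive y g -> is_Cprimitive z h ->
  is_Cprimitive (fun x => y x + z x) (fun x => g x + h x).
Proof.
move=> [y1 y2] [z1 z2]; split.
- rewrite (funext (fun x => complex_ReD (y x) (z x))) (funext (fun x => complex_ReD (g x) (h x))).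
  exact: is_primitiveD.
- rewrite (funext (fun x => complex_ImD (y x) (z x))) (funext (fun x => complex_ImD (g x) (h x))).
  exact: is_primitiveD.
Qed.

Lemma is_CprimitiveZ k y g : is_Cprimitive y g ->
  is_Cprimitive (fun x => k * y x) (fun x => k * g x).
Proof.
move=> [y1 y2]; split.
- rewrite (funext (fun x => complex_ReM k (y x))) (funext (fun x => complex_ReM k (g x))).
  apply: is_primitiveD; exact: is_primitiveZ.
- rewrite (funext (fun x => complex_ImM k (y x))) (funext (fun x => complex_ImM k (g x))).
  apply: is_primitiveD; exact: is_primitiveZ.
Qed.

Lemma is_Cprimitive_concat_shift (b : R) y g z h : 0 <= b <= 1 ->
  is_Cprimitive y g -> is_Cprimitive z h -> y 1 = z 0 ->
  is_Cprimitive (concat_shift b y z) (concat_shift b g h).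
Proof.
move=> b01 [y1 y2] [z1 z2] yz; split; rewrite !comp_concat_shift.
- by apply: is_primitive_concat_shift => //=; rewrite yz.
- by apply: is_primitive_concat_shift => //=; rewrite yz.
Qed.

Definition Ccontinuous01 y : Prop :=
  {within `[0, 1], continuous (fun x : R => complex.Re (y x))} /\
  {within `[0, 1], continuous (fun x : R => complex.Im (y x))}.

Lemma is_Cprimitive_continuous y g : is_Cprimitive y g -> Ccontinuous01 y.
Proof. by move=> [/is_primitive_continuous y1 /is_primitive_continuous]. Qed.

Lemma L2_01_continuous y : Ccontinuous01 y -> L2_01 y.
Proof.
move=> [y1 y2]; apply/L2_01P.
by split; exact: within_continuous_sqintegrable.
Qed.

(** [W22] does not mention the integrability of [y1]. It is recovered from continuity, [y1] being a
    primitive of [y2], which is integrable on [[0, 1]]. *)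
Lemma W22P y y1 y2 :
  W22 y y1 y2 <-> [/\ L2_01 y2, is_Cprimitive y1 y2 & is_Cprimitive y y1].
Proof.
have cE (p g : R -> R[i]) : is_Cprimitive p g ->
    forall x : R, 0 <= x <= 1 -> p x = p 0 + Cintegral `[0, x] g.
  move=> [[_ pr] [_ pi]] x x01; apply/eqP; rewrite eq_complex.
  by rewrite complex_ReD complex_ImD/= -pr// -pi// !eqxx.
have cP (p g : R -> R[i]) :
    L2_01 g -> (forall x : R, 0 <= x <= 1 -> p x = p 0 + Cintegral `[0, x] g) ->
    is_Cprimitive p g.
  by move=> /L2_01P[[g1 _] [g2 _]] pE; split; split=> // x x01; rewrite pE// ?complex_ReD ?complex_ImD.
split=> [[y22 y1E yE]|[y22 /cE y1E /cE yE]]; last by [].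
have y1P := cP _ _ y22 y1E; split=> //.
by apply: cP yE; apply: L2_01_continuous; exact: is_Cprimitive_continuous y1P.
Qed.

End ComplexValued.

(** * The homogeneous equation $-y''=\lambda y$ and its Wronskian *)

Section Homogeneous.
Context {R : realType}.
Notation mu := (@lebesgue_measure R).
Implicit Types (f g y z : R -> R[i]) (k lam : R[i]).

(* y'' = - lam y with y' = y1; unlike in W22, both y and y1 are then primitives
   of continuous functions. *)
Definition is_harmonic lam y y1 : Prop :=
  is_Cprimitive y y1 /\ is_Cprimitive y1 (fun x => - lam * y x).

Lemma is_harmonicD lam y y1 z z1 : is_harmonic lam y y1 -> is_harmonic lam z z1 ->
  is_harmonic lam (fun x => y x + z x) (fun x => y1 x + z1 x).
Proof.
move=> [yp y1p] [zp z1p]; split; first exact: is_CprimitiveD.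
rewrite (funext (fun x => mulrDr (- lam) (y x) (z x))).
exact: is_CprimitiveD.
Qed.

Lemma is_harmonicZ lam k y y1 : is_harmonic lam y y1 ->
  is_harmonic lam (fun x => k * y x) (fun x => k * y1 x).
Proof.
move=> [yp y1p]; split; first exact: is_CprimitiveZ.
rewrite (funext (fun x => mulrCA (- lam) k (y x))).
exact: is_CprimitiveZ.
Qed.

(** Provides the second solution: one solution and its derivative will span the solution space. *)
Lemma is_harmonic_derivative lam y y1 : is_harmonic lam y y1 ->
  is_harmonic lam y1 (fun x => - lam * y x).
Proof. by move=> [yp y1p]; split=> //; exact: is_CprimitiveZ. Qed.

Lemma is_Cprimitive_derive y g (x : R) : is_Cprimitive y g -> Ccontinuous01 g ->
  0 < x < 1 ->
  is_derive x 1 (fun t : R => complex.Re (y t)) (complex.Re (g x)) /\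
  is_derive x 1 (fun t : R => complex.Im (y t)) (complex.Im (g x)).
Proof.
move=> [y1 y2] [g1 g2] x01; split.
- exact: (is_primitive_derive y1 g1 x01).
- exact: (is_primitive_derive y2 g2 x01).
Qed.

(** The derivative $yz''-y''z$ vanishes on the open interval, since both second derivatives are
    $-\lambda$ times the function. Real and imaginary parts are treated separately, and continuity
    extends the result to the end points. *)
Lemma wronskian_constant lam y y1 z z1 (x : R) :
  is_harmonic lam y y1 -> is_harmonic lam z z1 -> 0 <= x <= 1 ->
  y x * z1 x - y1 x * z x = y 0 * z1 0 - y1 0 * z 0.
Proof.
move=> [yp y1p] [zp z1p] x01.
have y2c := is_Cprimitive_continuous (is_CprimitiveZ (- lam) yp).
have z2c := is_Cprimitive_continuous (is_CprimitiveZ (- lam) zp).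
have z1c := is_Cprimitive_continuous z1p.
have y1c := is_Cprimitive_continuous y1p.
have [[yrc yic] [zrc zic]] := (is_Cprimitive_continuous yp, is_Cprimitive_continuous zp).
have [[y1rc y1ic] [z1rc z1ic]] := (y1c, z1c).
have dy (t : R) (h : 0 < t < 1) := is_Cprimitive_derive yp y1c h.
have dz (t : R) (h : 0 < t < 1) := is_Cprimitive_derive zp z1c h.
have dy1 (t : R) (h : 0 < t < 1) := is_Cprimitive_derive y1p y2c h.
have dz1 (t : R) (h : 0 < t < 1) := is_Cprimitive_derive z1p z2c h.
have x00 : 0 <= (0 : R) <= 1 by rewrite lexx ler01.
move: yrc yic zrc zic y1rc y1ic z1rc z1ic dy dz dy1 dz1.
set yr := fun t => complex.Re (y t); set yi := fun t => complex.Im (y t).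
set zr := fun t => complex.Re (z t); set zi := fun t => complex.Im (z t).
set y1r := fun t => complex.Re (y1 t); set y1i := fun t => complex.Im (y1 t).
set z1r := fun t => complex.Re (z1 t); set z1i := fun t => complex.Im (z1 t).
move=> yrc yic zrc zic y1rc y1ic z1rc z1ic dy dz dy1 dz1.
have re t : complex.Re (y t * z1 t - y1 t * z t) =
    yr t * z1r t - yi t * z1i t - (y1r t * zr t - y1i t * zi t).
  rewrite /yr /yi /zr /zi /y1r /y1i /z1r /z1i.
  by case: (y t) (z t) (y1 t) (z1 t) => [? ?] [? ?] [? ?] [? ?] /=; ring.
have im t : complex.Im (y t * z1 t - y1 t * z t) =
    yr t * z1i t + yi t * z1r t - (y1r t * zi t + y1i t * zr t).
  rewrite /yr /yi /zr /zi /y1r /y1i /z1r /z1i.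
  by case: (y t) (z t) (y1 t) (z1 t) => [? ?] [? ?] [? ?] [? ?] /=; ring.
apply/eqP; rewrite eq_complex !re !im; apply/andP; split; apply/eqP.
- apply: (@derive0_constant _ (fun t => yr t * z1r t - yi t * z1i t - (y1r t * zr t - y1i t * zi t))) => //.
    by apply: within_continuousB; apply: within_continuousB; exact: within_continuousM.
  move=> t t01.
  have [yrd yid] := dy t t01; have [zrd zid] := dz t t01.
  have [y1rd y1id] := dy1 t t01; have [z1rd z1id] := dz1 t t01.
  (* Instance inference differentiates the bilinear expression from the derivatives in the context;
     [ring] checks that the terms cancel. *)
  apply: is_derive_eq; rewrite /GRing.scale/= !complex_ReM !complex_ImM; ring.
- apply: (@derive0_constant _ (fun t => yr t * z1i t + yi t * z1r t - (y1r t * zi t + y1i t * zr t))) => //.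
    by apply: within_continuousB; apply: within_continuousD; exact: within_continuousM.
  move=> t t01.
  have [yrd yid] := dy t t01; have [zrd zid] := dz t t01.
  have [y1rd y1id] := dy1 t t01; have [z1rd z1id] := dz1 t t01.
  apply: is_derive_eq; rewrite /GRing.scale/= !complex_ReM !complex_ImM; ring.
Qed.

End Homogeneous.

(** Lets [filterS] and its variants combine almost everywhere statements. *)
#[local] Instance lebesgue_ae_filter (R : realType) :
  Filter (nbhs (almost_everywhere (@lebesgue_measure R))).
Proof. exact: ae_filter_ringOfSetsType. Qed.

(** * The equation with a prescribed forcing term *)

Section Forced.
Context {R : realType}.
Notation mu := (@lebesgue_measure R).
Implicit Types (f g y z : R -> R[i]) (k lam : R[i]).

(* - y'' + f = lam y, that is, the equation of is_solution with q y(a) replaced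
   by a known function. *)
Definition is_forced f lam y y1 : Prop :=
  exists y2 : R -> R[i],
    W22 y y1 y2 /\
    {ae mu, forall x : R, 0 < x < 1 -> - y2 x + f x = lam * y x}.

Lemma is_forced_ext f g lam y y1 :
  {ae mu, forall x : R, 0 < x < 1 -> f x = g x} ->
  is_forced f lam y y1 -> is_forced g lam y y1.
Proof.
move=> fg [y2 [y22 E]]; exists y2; split=> //.
by apply: filterS2 fg E => x fg E x01; rewrite -fg// E.
Qed.

Lemma is_forcedD f g lam y y1 z z1 : is_forced f lam y y1 -> is_forced g lam z z1 ->
  is_forced (fun x => f x + g x) lam (fun x => y x + z x) (fun x => y1 x + z1 x).
Proof.
move=> [y2 [/W22P[y22 y1p yp] yE]] [z2 [/W22P[z22 z1p zp] zE]].
exists (fun x => y2 x + z2 x); split.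
  by apply/W22P; split; [exact: L2_01D|exact: is_CprimitiveD..].
by apply: filterS2 yE zE => x yE zE x01; rewrite mulrDr -yE// -zE//; ring.
Qed.

Lemma is_forcedZ k f lam y y1 : is_forced f lam y y1 ->
  is_forced (fun x => k * f x) lam (fun x => k * y x) (fun x => k * y1 x).
Proof.
move=> [y2 [/W22P[y22 y1p yp] yE]].
exists (fun x => k * y2 x); split.
  by apply/W22P; split; [exact: L2_01Z|exact: is_CprimitiveZ..].
by apply: filterS yE => x yE x01; rewrite mulrCA -yE//; ring.
Qed.

Lemma is_harmonic_forced lam y y1 : is_harmonic lam y y1 ->
  is_forced (fun=> 0) lam y y1.
Proof.
move=> [yp y1p]; exists (fun x => - lam * y x); split.
  apply/W22P; split=> //; apply: L2_01_continuous.
  exact: is_Cprimitive_continuous (is_CprimitiveZ (- lam) yp).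
by apply: aeW => x _; ring.
Qed.

(** A gain of regularity: the second derivative equals the continuous function [- lam * y] almost
    everywhere, and the primitive [y1] does not see the difference. *)
Lemma is_forced_harmonic lam y y1 : is_forced (fun=> 0) lam y y1 ->
  is_harmonic lam y y1.
Proof.
move=> [y2 [/W22P[y22 [y1r y1i] yp] yE]]; split=> //.
have [/within_continuous_integrable ir /within_continuous_integrable ii] :=
  is_Cprimitive_continuous (is_CprimitiveZ (- lam) yp).
have y2E : {ae mu, forall x : R, 0 < x < 1 -> y2 x = - lam * y x}.
  by apply: filterS yE => x yE x01; rewrite mulNr -yE//; ring.
split.
- by apply: is_primitive_ae y1r ir _; apply: filterS y2E => x + x01 => ->.
- by apply: is_primitive_ae y1i ii _; apply: filterS y2E => x + x01 => ->.
Qed.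

(** Used to discard the seam of a gluing, where neither piece supplies the equation. *)
Lemma ae_neq (p : R) : {ae mu, forall x : R, x != p}.
Proof.
exists [set p]; split=> //; first exact: lebesgue_measure_set1.
by move=> x /= /negP; rewrite negbK => /eqP.
Qed.

(** Matching values and slopes keep both [y] and [y1] indefinite integrals; the exceptional null
    sets of the two pieces are translated along with them. *)
Lemma is_forced_concat_shift (b : R) f g lam y y1 z z1 : 0 <= b <= 1 ->
  is_forced f lam y y1 -> is_forced g lam z z1 -> y 1 = z 0 -> y1 1 = z1 0 ->
  is_forced (concat_shift b f g) lam (concat_shift b y z) (concat_shift b y1 z1).
Proof.
move=> b01 [y2 [/W22P[y22 y1p yp] yE]] [z2 [/W22P[z22 z1p zp] zE]] yz y1z1.
exists (concat_shift b y2 z2); split.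
  by apply/W22P; split; [exact: L2_01_concat_shift|exact: is_Cprimitive_concat_shift..].
have := ae_translation b yE; have := ae_translation (b - 1) zE.
apply: filterS3 (ae_neq (1 - b)) => x xb zEx yEx x01.
have [b0 b1] := andP b01.
rewrite /concat_shift; case: ltP => [lt|].
  by apply: yEx; lra.
rewrite le_eqVlt eq_sym (negbTE xb)/= => lt.
by rewrite -addrA; apply: zEx; lra.
Qed.

End Forced.

(** * Rotation of the circle and transfer of characteristic functions *)

Section Rotation.
Context {R : realType}.
Implicit Types (y z : R -> R[i]) (lam : R[i]).

Lemma is_harmonic_concat_shift lam (b : R) y y1 z z1 : 0 <= b <= 1 ->
  is_harmonic lam y y1 -> is_harmonic lam z z1 -> y 1 = z 0 -> y1 1 = z1 0 ->
  is_harmonic lam (concat_shift b y z) (concat_shift b y1 z1).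
Proof.
move=> b01 [yp y1p] [zp z1p] yz y1z1; split; first exact: is_Cprimitive_concat_shift.
rewrite (comp_concat_shift (fun w => - lam * w)).
exact: is_Cprimitive_concat_shift.
Qed.

(* The Wronskian of S and S' is the constant S'(a)^2 = 1. *)
Lemma pythagoras lam (S S1 : R -> R[i]) (a x : R) : is_harmonic lam S S1 ->
  S a = 0 -> S1 a = 1 -> 0 <= a <= 1 -> 0 <= x <= 1 ->
  S1 x * S1 x + lam * (S x * S x) = 1.
Proof.
move=> Sh Sa S1a a01 x01; have Sh' := is_harmonic_derivative Sh.
have := wronskian_constant Sh Sh' x01.
rewrite -(wronskian_constant Sh Sh' a01) Sa S1a => W.
have -> : S1 x * S1 x = S x * (- lam * S x) - (0 * (- lam * 0) - 1 * 1) by rewrite -W; ring.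
ring.
Qed.

(* S(. - a), continued to the left of a by the solution u with u(1) = 0 and
   u'(1) = 1, solves the same equation, so that it is determined by its
   Wronskians with S and S'. *)
Lemma harmonic_translation lam (S S1 : R -> R[i]) (a : R) : is_harmonic lam S S1 ->
  S 0 = 0 -> S1 0 = 1 -> 0 <= a <= 1 ->
  S (1 - a) = S1 a * S 1 - S a * S1 1 /\
  S1 (1 - a) = S1 a * S1 1 + lam * (S a * S 1).
Proof.
move=> Sh S0 S10 a01; have Sh' := is_harmonic_derivative Sh.
have x00 : 0 <= (0 : R) <= 1 by rewrite lexx ler01.
have x11 : 0 <= (1 : R) <= 1 by rewrite lexx ler01.
have w1 := pythagoras Sh S0 S10 x00 x11.
pose u x := S1 1 * S x + - S 1 * S1 x.
pose u1 x := S1 1 * S1 x + - S 1 * (- lam * S x).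
have uh : is_harmonic lam u u1.
  by apply: is_harmonicD; exact: is_harmonicZ.
have b01 : 0 <= 1 - a <= 1 by lra.
have uS : u 1 = S 0 by rewrite S0 /u; ring.
have u1S : u1 1 = S1 0 by rewrite S10 -w1 /u1; ring.
have zh := is_harmonic_concat_shift b01 uh Sh uS u1S.
(* The Wronskians of the glued function with [S] and [S1] are compared at [a], where it has value 0
   and slope 1, and at 1, where it shows [S (1 - a)] and [S1 (1 - a)]. *)
have := wronskian_constant zh Sh x11; rewrite -(wronskian_constant zh Sh a01).
have := wronskian_constant zh Sh' x11; rewrite -(wronskian_constant zh Sh' a01).
rewrite !concat_shift_ge; [|lra..].
have -> : 1 + (1 - a) - 1 = 1 - a by lra.
have -> : a + (1 - a) - 1 = 0 by lra.
rewrite S0 S10; move: w1; clear.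
move: (S (1 - a)) (S1 (1 - a)) (S 1) (S1 1) (S a) (S1 a) => y y1 s c sa ca w1 W1 W2.
(* Cramer's rule: [W1] and [W2] are linear in [y] and [y1], with determinant 1 up to sign by
   [w1]. *)
split.
- rewrite -[y]mulr1 -w1.
  transitivity (c * (y * c - y1 * s) - s * (y * (- lam * s) - y1 * c)); first by ring.
  by rewrite W1 W2; ring.
- rewrite -[y1]mulr1 -w1.
  transitivity (- c * (y * (- lam * s) - y1 * c) - lam * s * (y * c - y1 * s)); first by ring.
  by rewrite W1 W2; ring.
Qed.

Lemma is_char_fun_rotate (q qa : R -> R[i]) (a : R) (gamma : R[i])
    (Delta : R[i] -> R[i]) : gamma != 0 -> 0 < a <= 1 ->
  (forall x : R, 0 < x < 1 - a -> qa x = q (x + a)) ->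
  (forall x : R, 1 - a < x < 1 -> qa x = gamma^-1 * q (x + a - 1)) ->
  is_char_fun q a gamma Delta -> is_char_fun qa 0 gamma Delta.
Proof.
move=> g0 /andP[a0 a1] qal qar DE lam.
have [C [C1 [S [S1 [[Csol [Ca C1a]] [Ssol [Sa S1a]] Delta_lam]]]]] := DE lam.
have a01 : 0 <= a <= 1 by rewrite ltW.
have Sh : is_harmonic lam S S1.
  apply: is_forced_harmonic; apply: is_forced_ext Ssol.
  by apply: aeW => x _; rewrite Sa mulr0.
have Sh' := is_harmonic_derivative Sh.
have x00 : 0 <= (0 : R) <= 1 by rewrite lexx ler01.
have w0 := pythagoras Sh Sa S1a a01 x00.
(* The functions $\sin(\rho x)/\rho$ and $\cos\rho x$, obtained from [S] and [S1]; [w0] normalises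
   them at 0. *)
pose s x := S1 0 * S x + - S 0 * S1 x.
pose c x := S1 0 * S1 x + - S 0 * (- lam * S x).
have sh : is_harmonic lam s c.
  by apply: is_harmonicD; [exact: is_harmonicZ|exact: is_harmonicZ].
have ch : is_harmonic lam c (fun x => - lam * s x) by exact: is_harmonic_derivative.
have s0 : s 0 = 0 by rewrite /s; ring.
have c0 : c 0 = 1 by rewrite /c -w0; ring.
(* [A] and [B] are the jumps of value and slope between [C] at 1 and [C / gamma] at 0; adding
   [A * c + B * s] removes them. *)
pose A := C 1 - gamma^-1 * C 0.
pose B := C1 1 - gamma^-1 * C1 0.
pose z x := gamma^-1 * C x + (A * c x + B * s x).
pose z1 x := gamma^-1 * C1 x + (A * (- lam * s x) + B * c x).
have zsol : is_forced (fun x => gamma^-1 * q x) lam z z1.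
  apply: is_forced_ext (is_forcedD (is_forcedZ gamma^-1 Csol)
    (is_harmonic_forced (is_harmonicD (is_harmonicZ A ch) (is_harmonicZ B sh)))).
  by apply: aeW => x _; rewrite Ca mulr1 addr0.
have Csol' : is_forced q lam C C1.
  by apply: is_forced_ext Csol; apply: aeW => x _; rewrite Ca mulr1.
have Cz : C 1 = z 0 by rewrite /z /A s0 c0; ring.
have C1z : C1 1 = z1 0 by rewrite /z1 /B s0 c0; ring.
have := is_forced_concat_shift a01 Csol' zsol Cz C1z.
set D := concat_shift a C z; set D1 := concat_shift a C1 z1 => Dsol.
have D0 : D 0 = 1.
  (* For [a = 1] the seam is at 0 and [D 0] is read from [z]; the matching condition turns it back
     into [C 1], which is [C a]. *)
  rewrite /D /concat_shift add0r; case: ltP => [_ //|h].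
  have aE : a = 1 by lra.
  by rewrite aE subrr -Cz -aE.
have D10 : D1 0 = 0.
  rewrite /D1 /concat_shift add0r; case: ltP => [_ //|h].
  have aE : a = 1 by lra.
  by rewrite aE subrr -C1z -aE.
have DE1 : D 1 = z a.
  by rewrite /D concat_shift_ge ?(addrC 1) ?addrK//; lra.
have D1E1 : D1 1 = z1 a.
  by rewrite /D1 concat_shift_ge ?(addrC 1) ?addrK//; lra.
exists D, D1, s, c; split.
- split=> //; apply: is_forced_ext Dsol.
  apply: filterS (ae_neq (1 - a)) => x xa /andP[x0 x1].
  rewrite D0 mulr1 /concat_shift; case: ltP => [lt|].
    by rewrite qal// x0 lt.
  by rewrite le_eqVlt eq_sym (negbTE xa)/= => lt; rewrite qar// lt.
- split=> //; apply: is_forced_ext (is_harmonic_forced sh).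
  by apply: aeW => x _; rewrite s0 mulr0.
rewrite Delta_lam /boundary_det D0 D10 DE1 D1E1 s0 c0 /z /z1 Ca C1a.
rewrite /A /B /s /c Sa S1a.
clear -w0 g0.
move: (C 0) (C 1) (C1 0) (C1 1) (S 0) (S 1) (S1 0) (S1 1) w0 => C0 Cx D0 D1 S0 Sx T0 Tx w0.
have gk : gamma * gamma^-1 = 1 by rewrite divff.
move: gamma^-1 gk => k gk.
(* [ring] uses its equations as rewrite rules, so a monomial is isolated on the left. *)
have {}w0 : T0 * T0 = 1 - lam * (S0 * S0) by rewrite -w0 addrK.
ring: w0 gk.
Qed.

Lemma is_char_fun_unrotate (q qa : R -> R[i]) (a : R) (gamma : R[i])
    (Delta : R[i] -> R[i]) : gamma != 0 -> 0 < a <= 1 ->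
  (forall x : R, 0 < x < 1 - a -> qa x = q (x + a)) ->
  (forall x : R, 1 - a < x < 1 -> qa x = gamma^-1 * q (x + a - 1)) ->
  is_char_fun qa 0 gamma Delta -> is_char_fun q a gamma Delta.
Proof.
move=> g0 /andP[a0 a1] qal qar DE lam.
have [C [C1 [S [S1 [[Csol [C0 C10]] [Ssol [S0 S10]] Delta_lam]]]]] := DE lam.
have a01 : 0 <= a <= 1 by rewrite ltW.
have b01 : 0 <= 1 - a <= 1 by lra.
have x00 : 0 <= (0 : R) <= 1 by rewrite lexx ler01.
have Sh : is_harmonic lam S S1.
  apply: is_forced_harmonic; apply: is_forced_ext Ssol.
  by apply: aeW => x _; rewrite S0 mulr0.
have Sh' := is_harmonic_derivative Sh.
have wa := pythagoras Sh S0 S10 x00 a01.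
have [SE S1E] := harmonic_translation Sh S0 S10 a01.
pose s x := S1 a * S x + - S a * S1 x.
pose c x := S1 a * S1 x + - S a * (- lam * S x).
have sh : is_harmonic lam s c by apply: is_harmonicD; exact: is_harmonicZ.
have ch := is_harmonic_derivative sh.
have sa : s a = 0 by rewrite /s; ring.
have ca : c a = 1 by rewrite -wa /c; ring.
pose A := C 1 - gamma^-1.
pose z x := gamma^-1 * C x + (A * S1 x + C1 1 * S x).
pose z1 x := gamma^-1 * C1 x + (A * (- lam * S x) + C1 1 * S1 x).
have zsol : is_forced (fun x => gamma^-1 * qa x) lam z z1.
  apply: is_forced_ext (is_forcedD (is_forcedZ gamma^-1 Csol)
    (is_harmonic_forced (is_harmonicD (is_harmonicZ A Sh') (is_harmonicZ (C1 1) Sh)))).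
  by apply: aeW => x _; rewrite C0 mulr1 addr0.
have Csol' : is_forced qa lam C C1.
  by apply: is_forced_ext Csol; apply: aeW => x _; rewrite C0 mulr1.
have Cz : C 1 = z 0 by rewrite /z /A S0 S10 C0; ring.
have C1z : C1 1 = z1 0 by rewrite /z1 S0 S10 C10; ring.
have := is_forced_concat_shift b01 Csol' zsol Cz C1z.
set D := concat_shift (1 - a) C z; set D1 := concat_shift (1 - a) C1 z1 => Dsol.
have shiftE : [/\ 1 - (1 - a) = a, a + (1 - a) - 1 = 0,
    1 + (1 - a) - 1 = 1 - a & 0 + (1 - a) = 1 - a].
  by split; ring.
have [aE aE0 aE1 aE2] := shiftE.
have D0 : D 0 = C (1 - a) by rewrite /D /concat_shift aE a0 aE2.
have D10 : D1 0 = C1 (1 - a) by rewrite /D1 /concat_shift aE a0 aE2.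
have Da : D a = C 1 by rewrite /D concat_shift_ge ?aE// aE0.
have D1a : D1 a = C1 1 by rewrite /D1 concat_shift_ge ?aE// aE0.
have DE1 : D 1 = z (1 - a) by rewrite /D concat_shift_ge ?aE// aE1.
have D1E1 : D1 1 = z1 (1 - a) by rewrite /D1 concat_shift_ge ?aE// aE1.
(* The defects of [gamma * D] at [a] from value 1 and slope 0. *)
pose A' := 1 - gamma * C 1.
pose B' := - (gamma * C1 1).
pose E x := gamma * D x + (A' * c x + B' * s x).
pose E1 x := gamma * D1 x + (A' * (- lam * s x) + B' * c x).
have Ea : E a = 1 by rewrite /E Da sa ca /A'; ring.
have E1a : E1 a = 0 by rewrite /E1 D1a sa ca /B'; ring.
exists E, E1, s, c; split.
- split=> //; apply: is_forced_ext (is_forcedD (is_forcedZ gamma Dsol)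
    (is_harmonic_forced (is_harmonicD (is_harmonicZ A' ch) (is_harmonicZ B' sh)))).
  apply: filterS (ae_neq a) => x xa /andP[x0 x1].
  rewrite Ea mulr1 addr0 /concat_shift aE; case: ltP => [lt|].
    rewrite qar; last by lra.
    by rewrite mulrA divff// mul1r; congr q; ring.
  rewrite le_eqVlt eq_sym (negbTE xa)/= => lt; rewrite qal; last by lra.
  by rewrite mulrA divff// mul1r; congr q; ring.
- split=> //; apply: is_forced_ext (is_harmonic_forced sh).
  by apply: aeW => x _; rewrite sa mulr0.
(* The unknown values of [C] and [C1] at [1 - a] cancel in [E 0 - gamma * E 1] and its analogue for
   [E1], while [SE] and [S1E] eliminate those of [S] and [S1]. *)
rewrite Delta_lam /boundary_det /E /E1 D0 D10 DE1 D1E1 C0 C10 S0 S10 /z /z1 SE S1E.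
rewrite /A' /B' /A /s /c S0 S10.
have gk : gamma * gamma^-1 = 1 by rewrite divff.
have {}wa : S1 a * S1 a = 1 - lam * (S a * S a) by rewrite -wa addrK.
move: gamma^-1 gk wa => k gk.
move: (S a) (S1 a) (S 1) (S1 1) (C 1) (C1 1) (C (1 - a)) (C1 (1 - a)).
move=> ya ya1 y1 yy1 x x1 p p1 {}wa.
ring: wa gk.
Qed.

End Rotation.

Theorem lemma4 (R : realType) (q qa : R -> R[i]) (a : R) (gamma : R[i])
  (hq : L2_01 q) (hgamma : gamma != 0) (ha : 0 < a <= 1)
  (hqa_left : forall x : R, 0 < x < 1 - a -> qa x = q (x + a))
  (hqa_right : forall x : R, 1 - a < x < 1 -> qa x = gamma^-1 * q (x + a - 1)) :
  forall (lam : R[i]) (m : nat),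
    spectrum q a gamma lam m <-> spectrum qa 0 gamma lam m.
Proof.
move=> lam m; split=> -[Delta [DE zD]]; exists Delta; split=> //.
- exact: is_char_fun_rotate DE.
- exact: is_char_fun_unrotate DE.
Qed.
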